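(* Let $H$ be a directed layered graph with special vertices $r$ and $g$ satisfying the DDFS Requirement (as defined in the context). Then the double depth first search (DDFS) procedure run on $H$ with roots $r$ and $g$ correctly determines whether Case 1 (a bottleneck exists) or Case 2 (no bottleneck exists) holds, and: in Case 1 it outputs the highest bottleneck $b$ together with a partition of $V_b\setminus\{b\}$ into a red set $S_R\ni r$ and a green set $S_G\ni g$ such that there is a directed path from $r$ to $b$ within $S_R\cup\{b\}$ and a directed path from $g$ to $b$ within $S_G\cup\{b\}$, and it outputs spanning trees $T_r$ of $S_R\cup\{b\}$ rooted at $r$ and $T_g$ of $S_G\cup\{b\}$ rooted at $g$; in Case 2 it outputs distinct vertices $r_0,g_0$ of the lowest layer and vertex-disjoint directed paths from $r$ to $r_0$ and from $g$ to $g_0$. The running time is $O(|E_b|)$ in Case 1 and $O(|E_p|)$ in Case 2.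
   Context: $H=(V,E)$ is a directed graph whose vertex set is partitioned into layers $l_h,\dots,l_0$ ($h>0$), with layer number $l(v)$ for $v\in V$; every edge goes from a higher layer to a strictly lower (not necessarily consecutive) layer. $r,g\in V$ are two special vertices (red and green). DDFS Requirement: from every vertex of $H$ there is a directed path to a vertex of layer $l_0$. A vertex $v$ is a bottleneck if every directed path from $r$ to layer $l_0$ and every directed path from $g$ to layer $l_0$ contains $v$ ($v$ may be $r$, $g$, or in $l_0$). Case 1: a bottleneck exists; the bottleneck of highest layer is then unique and is called the highest bottleneck $b$; $V_b$ ($E_b$) is the set of vertices (edges) lying on paths from $r$ or $g$ to $b$. Case 2: no bottleneck exists; then there are distinct $r_0,g_0$ in $l_0$ with vertex-disjoint paths from $r$ to $r_0$ and $g$ to $g_0$, and $E_p$ is the set of edges lying on paths from $r$ or $g$ to $r_0$ or $g_0$. DDFS grows two depth-first search trees $T_r,T_g$ rooted at $r,g$, with centers of activity $C_r,C_g$ initialized to $r,g$; initially all vertices are unvisited and all edges unexplored. A move of a tree with center $v$: pick an unexplored out-edge $(v,u)$; if $u$ is unvisited, mark it visited and colored by that tree, make $v$ its parent and move the center to $u$; if $u$ is visited, try another edge; if all out-edges of $v$ are explored, backtrack to the parent of $v$. If $l(C_r)\ge l(C_g)$ then $T_r$ moves, otherwise $T_g$ moves. If $C_r=C_g=v$: $v$ is given to $T_g$ and $T_r$ backtracks and searches for a vertex at least as deep as $v$; if it finds one, search resumes; if $T_r$ backtracks to its Barrier (initially $r$), then $v$ is given to $T_r$, the Barrier is set to $v$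 (and $T_r$ never backtracks past its Barrier), and $T_g$ backtracks from $v$ to search for a vertex at least as deep as $v$; if it succeeds search resumes, and if $T_g$ backtracks all the way to $g$, $v$ is declared the highest bottleneck and DDFS terminates (Case 1). If the two centers reach distinct vertices of layer $l_0$, DDFS terminates in Case 2.
   Formalization: r ∈ S_R (g ∈ S_G) is claimed only if r ≠ b (g ≠ b); bounds are O(max(1,|E_b|)), O(max(1,|E_p|)); roots start visited, a center may enter the other center, and a retreat fails only when the Barrier's (g's) out-edges are exhausted too. *)

(* Defs.v *)
From HB Require Import structures.
From mathcomp Require Import all_boot.
From mathcomp Require Import boolp.

Set Implicit Arguments.
Unset Strict Implicit.
Unset Printing Implicit Defensive.

Record layered_digraph := LayeredDigraph {
  vertex :> finType;
  edge : rel vertex;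
  height : nat;
  layer : vertex -> nat;
  height_gt0 : 0 < height;
  layer_le : forall v, layer v <= height;
  edge_layer : forall u v, edge u v -> layer v < layer u
}.

(* [p] lists all the vertices of the path, both endpoints included. *)
Definition dipath (H : layered_digraph) (x y : H) (p : seq H) : bool :=
  if p is z :: q then [&& z == x, path (@edge H) z q & last z q == y]
  else false.

Definition ddfs_requirement (H : layered_digraph) : Prop :=
  forall x : H, exists y p, layer y = 0 /\ dipath x y p.

Definition bottleneck (H : layered_digraph) (r g v : H) : Prop :=
  forall x y p, x \in [set r; g] -> layer y = 0 -> dipath x y p -> v \in p.

Definition highest_bottleneck (H : layered_digraph) (r g b : H) : Prop :=
  bottleneck r g b /\
  forall v, bottleneck r g v -> v != b -> layer v < layer b.

(* Vertices, resp. edges, lying on the paths from [A] to [B]. *)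
Definition vertices_on (H : layered_digraph) (A B : {set H}) : {set H} :=
  [set v | `[< exists x y p,
                 [/\ x \in A, y \in B, dipath x y p & v \in p] >]].

Definition edges_on (H : layered_digraph) (A B : {set H}) : {set H * H} :=
  [set e | `[< exists x y p,
                 [/\ x \in A, y \in B, dipath x y p
                   & e \in zip p (behead p)] >]].

Definition spanning_tree (H : layered_digraph) (root : H) (S : {set H})
    (T : {set H * H}) : Prop :=
  [/\ root \in S,
      forall e, e \in T -> [/\ edge e.1 e.2, e.1 \in S & e.2 \in S],
      forall v, v \in S -> #|[set e in T | e.2 == v]| = (v != root)
    & forall v, v \in S -> connect (fun x y => (x, y) \in T) root v].

Inductive side := Red | Green.

Definition is_red (t : side) := if t is Red then true else false.
Definition side_of_bool (c : bool) := if c then Red else Green.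
Lemma is_redK : cancel is_red side_of_bool. Proof. by case. Qed.
HB.instance Definition _ := Equality.copy side (can_type is_redK).

Definition other (t : side) := if t is Red then Green else Red.

Definition upd (A : eqType) (B : Type) (f : A -> B) (a : A) (b : B) : A -> B :=
  fun x => if x == a then b else f x.

(* [Retreat t v]: the centers have met at [v], and tree [t] is backtracking
   from [v] in search of a vertex at least as deep as [v]; the center of the
   other tree waits at [v]. *)
Inductive phase (V : Type) :=
  | Advance
  | Retreat of side & V
  | HaltBottleneck of V
  | HaltDisjoint.
Arguments Advance {V}.
Arguments HaltDisjoint {V}.

(* [colour s v = None] means that [v] is unvisited.  Each tree has its own
   parent pointers: a vertex at which the centers meet has a parent in both. *)
Record state (H : layered_digraph) := State {
  st_phase : phase H;
  center : side -> H;
  barrier : H;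
  colour : H -> option side;
  parent : side -> H -> option H;
  explored : {set H * H}
}.

Definition ddfs_init (H : layered_digraph) (r g : H) : state H :=
  {| st_phase := Advance;
     center := fun t => if t is Red then r else g;
     barrier := r;
     colour := upd (upd (fun=> None) r (Some Red)) g (Some Green);
     parent := fun _ _ => None;
     explored := set0 |}.

Definition both_lowest (H : layered_digraph) (s : state H) : bool :=
  (layer (center s Red) == 0) && (layer (center s Green) == 0).

Definition moves (H : layered_digraph) (s : state H) (t : side) : bool :=
  match st_phase s with
  | Advance =>
      [&& center s Red != center s Green, ~~ both_lowest s
        & t == if layer (center s Green) <= layer (center s Red)
               then Red else Green]
  | Retreat t' _ => t == t'
  | _ => false
  end.

(* A retreating tree takes no edge out of the meeting vertex itself. *)
Definition at_meeting (H : layered_digraph) (s : state H) (t : side) : bool :=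
  if st_phase s is Retreat _ v then center s t == v else false.

Definition can_explore (H : layered_digraph) (s : state H) (t : side) (u : H) :
    bool :=
  [&& moves s t, ~~ at_meeting s t, edge (center s t) u
    & (center s t, u) \notin explored s].

Definition must_backtrack (H : layered_digraph) (s : state H) (t : side) :
    bool :=
  moves s t &&
  (at_meeting s t ||
   [forall u, edge (center s t) u ==> ((center s t, u) \in explored s)]).

(* The vertex past which tree [t] does not backtrack. *)
Definition backtrack_limit (H : layered_digraph) (g : H) (s : state H)
    (t : side) : H :=
  if t is Red then barrier s else g.

Definition meets (H : layered_digraph) (s : state H) (t : side) (u : H) :
    bool :=
  if st_phase s is Advance then u == center s (other t) else false.

Definition phase_after_visit (H : layered_digraph) (s : state H) (u : H) :
    phase H :=
  if st_phase s is Retreat t v then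
    if layer u <= layer v then Advance else Retreat t v
  else st_phase s.

(* One step is one constant-time operation: examining one edge, backtracking
   along one tree edge, or one change of phase.  The edge to be explored is
   chosen nondeterministically. *)
Inductive ddfs_step (H : layered_digraph) (g : H) (s : state H) :
    state H -> Prop :=
  | StepVisit t u of can_explore s t u & colour s u = None :
      ddfs_step g s
        {| st_phase := phase_after_visit s u;
           center := upd (center s) t u;
           barrier := barrier s;
           colour := upd (colour s) u (Some t);
           parent := upd (parent s) t
                       (upd (parent s t) u (Some (center s t)));
           explored := (center s t, u) |: explored s |}
  (* The head of the edge is visited, but is the center of the other tree. *)
  | StepReachCenter t u of can_explore s t u & meets s t u :
      ddfs_step g s
        {| st_phase := st_phase s;
           center := upd (center s) t u;
           barrier := barrier s;
           colour := colour s;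
           parent := upd (parent s) t
                       (upd (parent s t) u (Some (center s t)));
           explored := (center s t, u) |: explored s |}
  | StepSkip t u of can_explore s t u & colour s u <> None & ~~ meets s t u :
      ddfs_step g s
        {| st_phase := st_phase s;
           center := center s;
           barrier := barrier s;
           colour := colour s;
           parent := parent s;
           explored := (center s t, u) |: explored s |}
  | StepBacktrack t w of must_backtrack s t
      & center s t != backtrack_limit g s t
      & parent s t (center s t) = Some w :
      ddfs_step g s
        {| st_phase := st_phase s;
           center := upd (center s) t w;
           barrier := barrier s;
           colour := colour s;
           parent := parent s;
           explored := explored s |}
  | StepMeet v of st_phase s = Advance & center s Red = v
      & center s Green = v :
      ddfs_step g s
        {| st_phase := Retreat Red v;
           center := center s;
           barrier := barrier s;
           colour := upd (colour s) v (Some Green);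
           parent := parent s;
           explored := explored s |}
  | StepRedFails v of st_phase s = Retreat Red v & must_backtrack s Red
      & center s Red = backtrack_limit g s Red :
      ddfs_step g s
        {| st_phase := Retreat Green v;
           center := upd (center s) Red v;
           barrier := v;
           colour := upd (colour s) v (Some Red);
           parent := parent s;
           explored := explored s |}
  | StepGreenFails v of st_phase s = Retreat Green v & must_backtrack s Green
      & center s Green = backtrack_limit g s Green :
      ddfs_step g s
        {| st_phase := HaltBottleneck v;
           center := center s;
           barrier := barrier s;
           colour := colour s;
           parent := parent s;
           explored := explored s |}
  | StepHalt of st_phase s = Advance & center s Red <> center s Green
      & both_lowest s :
      ddfs_step g s
        {| st_phase := HaltDisjoint;
           center := center s;
           barrier := barrier s;
           colour := colour s;
           parent := parent s;
           explored := explored s |}.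

Inductive ddfs_run (H : layered_digraph) (g : H) :
    nat -> state H -> state H -> Prop :=
  | RunNil s : ddfs_run g 0 s s
  | RunCons n s s' s'' of ddfs_step g s s' & ddfs_run g n s' s'' :
      ddfs_run g n.+1 s s''.

Inductive result (H : layered_digraph) :=
  | Case1 (b : H) (SR SG : {set H}) (Tr Tg : {set H * H})
  | Case2 (r0 g0 : H) (pr pg : seq H).
Arguments Case1 {H}.
Arguments Case2 {H}.

Definition coloured (H : layered_digraph) (s : state H) (t : side) : {set H} :=
  [set v | colour s v == Some t].

Definition tree_edges (H : layered_digraph) (s : state H) (t : side)
    (S : {set H}) : {set H * H} :=
  [set e | (e.2 \in S) && (parent s t e.2 == Some e.1)].

(* The path of parent pointers above [x], listed downwards and cut off after
   [n] pointers. *)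
Fixpoint tree_path (H : layered_digraph) (par : H -> option H) (n : nat)
    (x : H) : seq H :=
  if n is m.+1 then
    if par x is Some w then rcons (tree_path par m w) x else [:: x]
  else [:: x].

Definition ddfs_result (H : layered_digraph) (s : state H) :
    option (result H) :=
  match st_phase s with
  | HaltBottleneck b =>
      let SR := coloured s Red :\ b in
      let SG := coloured s Green :\ b in
      Some (Case1 b SR SG (tree_edges s Red (b |: SR))
                          (tree_edges s Green (b |: SG)))
  | HaltDisjoint =>
      Some (Case2 (center s Red) (center s Green)
              (tree_path (parent s Red) #|H| (center s Red))
              (tree_path (parent s Green) #|H| (center s Green)))
  | _ => None
  end.

(* Main.v *)
(** While both trees advance, every visited vertex other than the centers lies
    at least as high as the higher center, whose out-edges are all unexplored.
    So the moving tree never skips an edge nor backtracks, and the centers can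
    only meet strictly below every other visited vertex.  At any time a visited
    vertex with an unexplored out-edge lies on the stack of one of the trees.
    If both trees retreat from a meeting vertex [b] in vain, every visited
    vertex but [b] is fully explored and higher than [b], hence [b] is a
    bottleneck; the two tree paths to [b] share no other vertex, hence it is the
    highest one.  If the centers reach two vertices of layer 0, the two tree
    paths are disjoint because of their colours.  In both cases every visited
    vertex leads to the final centers, so that every explored edge counts in the
    bound.  The number of steps is at most four times the number of explored
    edges plus three, because a backtracking step is paid for by the exploration
    of the tree edge, and a meeting by the edge that produced it. *)

Require Import Defs.
From mathcomp Require Import all_boot.
From mathcomp Require Import boolp zify.

Set Implicit Arguments.
Unset Strict Implicit.
Unset Printing Implicit Defensive.

(** * Pointwise updates and the two sides *)

Lemma upd_same (A : eqType) (B : Type) (f : A -> B) a b : upd f a b a = b.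
Proof. by rewrite /upd eqxx. Qed.

Lemma upd_other (A : eqType) (B : Type) (f : A -> B) a b x :
  x != a -> upd f a b x = f x.
Proof. by rewrite /upd => /negbTE ->. Qed.

Lemma sideP (t t' : side) : t' = t \/ t' = other t /\ t' != t.
Proof. by case: t; case: t'; [left|right|right|left]. Qed.

Lemma other_neq (t : side) : other t != t.
Proof. by case: t. Qed.

(** * Directed paths and induction along the layers *)

Section Graph.
Variable H : layered_digraph.
Implicit Types (x y z u v w : H) (p q : seq H).

Lemma path_layer x p y : path (@edge H) x p -> y \in p -> layer y < layer x.
Proof.
elim: p x => //= z p IH x /andP[/edge_layer zx /IH {}IH].
rewrite inE => /predU1P[->//|/IH yz]; exact: ltn_trans yz zx.
Qed.

Lemma belast_layer x p y : path (@edge H) x p -> y \in belast x p ->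
  layer (last x p) < layer y.
Proof.
elim: p x => //= z p IH x /andP[xz zp]; rewrite inE => /predU1P[->|]; last exact: IH.
by apply: (@path_layer _ (z :: p)); rewrite /= ?xz ?mem_last.
Qed.

Lemma connect_layer x y :
  connect (@edge H) x y -> x = y \/ layer y < layer x.
Proof.
case/connectP=> [[|z p] xp ->]; first by left.
by right; apply: path_layer xp _; rewrite /= mem_last.
Qed.

Lemma dipathP x y p :
  reflect (exists q, [/\ p = x :: q, path (@edge H) x q & last x q = y])
          (dipath x y p).
Proof.
case: p => [|z q]; first by right=> -[q []].
apply: (iffP and3P) => [[/eqP-> pq /eqP lq]|[q' [[-> ->] pq /eqP ->]]].
  by exists q.
by rewrite pq.
Qed.

Lemma edge_requirement x :
  ddfs_requirement H -> 0 < layer x -> exists u, edge x u.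
Proof.
move=> req lx; have [y [p [ly /dipathP[[|u q] [_ xq]]]]] := req x.
  by move=> xy; rewrite -xy /= in ly; rewrite ly in lx.
by move: xq => /= /andP[xu _] _; exists u.
Qed.

(** Layers are bounded by [height H], so the induction may climb towards higher vertices, the
    direction of parent pointers. *)
Lemma layer_ind (P : H -> Prop) :
  (forall x, (forall w, layer x < layer w -> P w) -> P x) -> forall x, P x.
Proof.
move=> IH x; have [n] := ubnP (height H - layer x).
elim: n x => // n IHn x xn; apply: IH => w xw; apply: IHn.
have := layer_le w; lia.
Qed.

Lemma layer_ind_down (P : H -> Prop) :
  (forall x, (forall w, layer w < layer x -> P w) -> P x) -> forall x, P x.
Proof.
move=> IH x; have [n] := ubnP (layer x).
elim: n x => // n IHn x xn; apply: IH => w xw; apply: IHn; lia.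
Qed.

Lemma connect_vertices_on (A B : {set H}) a b x :
  a \in A -> b \in B -> connect (@edge H) a x -> connect (@edge H) x b ->
  x \in vertices_on A B.
Proof.
move=> aA bB /connectP[p ap ->] /connectP[q xq bE].
rewrite inE; apply/asboolP; exists a, b, (a :: p ++ q).
split=> //; last by rewrite -cat_cons mem_cat mem_last.
by apply/dipathP; exists (p ++ q); rewrite cat_path ap last_cat.
Qed.

Lemma mem_zip_behead a p u q :
  (last a p, u) \in zip (a :: p ++ u :: q) (p ++ u :: q).
Proof.
elim: p a => [|z p IH] a /=; first by rewrite inE eqxx.
by rewrite inE IH orbT.
Qed.

Lemma connect_edges_on (A B : {set H}) a b x u :
  a \in A -> b \in B -> connect (@edge H) a x -> edge x u ->
  connect (@edge H) u b -> (x, u) \in edges_on A B.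
Proof.
move=> aA bB /connectP[p ap ->] xu /connectP[q uq bE].
rewrite inE; apply/asboolP; exists a, b, (a :: p ++ u :: q).
split=> //; last exact: mem_zip_behead.
by apply/dipathP; exists (p ++ u :: q); rewrite cat_path ap last_cat /= xu uq.
Qed.

End Graph.

(** * Invariants of the search, phase by phase *)

Section Invariant.
Variables (H : layered_digraph) (r g : H).
Hypothesis req : ddfs_requirement H.
Implicit Types (x y u v w : H) (s : state H) (t : side) (st : side -> seq H).

Definition root t := if t is Red then r else g.
Definition finished s x : bool :=
  [forall u, edge x u ==> ((x, u) \in explored s)].
(** The colour tested is that of the parent: a meeting vertex has a single colour but must be
    attached to both trees. *)
Definition owned s t x : Prop :=
  x = root t \/ exists2 w, parent s t x = Some w & colour s w = Some t.

(* [st t] lists the proper ancestors of the center of [t], up to the vertex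
   past which [t] does not backtrack. *)
Record tree_inv s st : Prop := TreeInv {
  visited_center : forall t, colour s (center s t) <> None;
  visited_root : forall t, colour s (root t) <> None;
  explored_edge : forall x y, (x, y) \in explored s ->
    [/\ edge x y, colour s x <> None & colour s y <> None];
  parent_explored : forall t x w,
    parent s t x = Some w -> (w, x) \in explored s;
  parent_root : forall t, parent s t (root t) = None;
  colour_owned : forall t x, colour s x = Some t -> owned s t x;
  center_owned : forall t, owned s t (center s t);
  stack_path : forall t,
    path (fun x y => parent s t x == Some y) (center s t) (st t);
  stack_last : forall t, last (center s t) (st t) = backtrack_limit g s t;
  unfinished_stack : forall x, colour s x <> None ->
    finished s x \/ exists t, x \in center s t :: st t
}.

Arguments visited_center [s st] _ t _.
Arguments visited_root [s st] _ t _.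

(** Strictness over some center in [advance_layer] puts every other visited vertex above a vertex
    where the centers meet, and above layer 0 once both centers are there. The second alternative of
    [advance_red] allows for [r = g], where the initial colouring turns the common root green. *)
Record advance_inv s : Prop := AdvanceInv {
  advance_fresh : forall t u, (center s t, u) \notin explored s;
  advance_layer : forall x, colour s x <> None ->
    (forall t, x <> center s t) ->
    (forall t, layer (center s t) <= layer x) /\
    (exists t, layer (center s t) < layer x);
  advance_colour : center s Red <> center s Green ->
    forall t, colour s (center s t) = Some t;
  advance_green : colour s g = Some Green;
  advance_red : colour s r = Some Red \/ forall t, center s t = r
}.

(** What stays true of the meeting vertex through both retreats and the halt. [meeting_root] exempts
    a root at which the centers meet, as that vertex has one colour for two trees. *)
Record meeting_inv s v : Prop := MeetingInv {
  meeting_fresh : forall u, (v, u) \notin explored s;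
  meeting_layer : forall x, colour s x <> None -> x <> v -> layer v < layer x;
  meeting_owned : forall t, owned s t v;
  meeting_root : forall t, root t <> v -> colour s (root t) = Some t
}.

(** [retreat_root] records that a tree rooted at the meeting vertex cannot leave it, since a root
    has no parent pointer. *)
Record retreat_inv s t v : Prop := RetreatInv {
  retreat_meeting : meeting_inv s v;
  retreat_other : center s (other t) = v;
  retreat_colour : colour s v = Some (other t);
  retreat_center : center s t <> v -> colour s (center s t) = Some t;
  retreat_root : v = root t -> center s t = v;
  retreat_barrier : t = Green -> barrier s = v
}.

Definition phase_inv s : Prop :=
  match st_phase s with
  | Advance => advance_inv s
  | Retreat t v => retreat_inv s t v
  | HaltBottleneck v => meeting_inv s v /\
      forall x, colour s x <> None -> x <> v -> finished s x
  | HaltDisjoint => [/\ advance_inv s, center s Red <> center s Green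
      & both_lowest s]
  end.

(* Steps not charged to an explored edge: at most one meeting, one failure of
   either tree, and the halting step remain unpaid at any time. *)
Definition credit s : nat :=
  match st_phase s with
  | Advance => if center s Red == center s Green then 0 else 2
  | Retreat Red _ => 1
  | Retreat Green _ => 2
  | _ => 3
  end.

Definition nb_explored s : nat := #|explored s|.

Lemma nb_explored_new s s' e : explored s' = e |: explored s ->
  e \notin explored s -> nb_explored s' = (nb_explored s).+1.
Proof. by rewrite /nb_explored => -> ne; rewrite cardsU1 ne. Qed.

(** A potential argument: stack entries count as steps already owed. The four units per explored
    edge cover the exploring step, the later pop of the stack entry, and a drop of [credit] by at
    most 2. *)
Definition ddfs_inv n s : Prop := exists st,
  [/\ tree_inv s st, phase_inv s
    & n + size (st Red) + size (st Green) <= 4 * nb_explored s + credit s].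

(** * Initial state, and consequences of the tree invariant *)

Lemma init_inv : ddfs_inv 0 (ddfs_init r g).
Proof.
exists (fun=> [::]); split=> //=.
- split=> //=.
  + by case; rewrite /upd /=; do 2 case: eqP => //.
  + by case; rewrite /upd /=; do 2 case: eqP => //.
  + by move=> x y; rewrite inE.
  + move=> t x; rewrite /upd /owned; case: eqP => [-> [<-]|_]; first by left.
    by case: eqP => // -> [<-]; left.
  + by case; left.
  + move=> x; rewrite /upd; case: eqP => [->|_].
      by right; exists Green; rewrite mem_head.
    by case: eqP => // ->; right; exists Red; rewrite mem_head.
- split=> //=.
  + by move=> t u; rewrite inE.
  + move=> x vx cx; case: vx; rewrite !upd_other //; apply/eqP.
      exact: (cx Red).
    exact: (cx Green).
  + move=> rg; case; last exact: upd_same.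
    by rewrite upd_other ?upd_same //; apply/eqP.
  + by rewrite upd_same.
  + rewrite /upd; case: eqP => [->|_]; last by rewrite eqxx; left.
    by right; case.
Qed.

Lemma parent_edge s st t x w : tree_inv s st -> parent s t x = Some w -> edge w x.
Proof. by move=> I /(parent_explored I)/(explored_edge I)[]. Qed.

Lemma stack_layer s st t x : tree_inv s st -> x \in st t ->
  layer (center s t) < layer x.
Proof.
move=> I; have := stack_path I t; move: (st t) (center s t).
elim=> //= a q IH c /andP[/eqP /(parent_edge I) /edge_layer ca /IH {}IH].
by rewrite inE => /predU1P[->//|/IH]; apply: ltn_trans.
Qed.

(** Stack entries are strictly higher than the center, so the last one cannot be the center
    itself. *)
Lemma stack_nil s st t : tree_inv s st ->
  center s t = backtrack_limit g s t -> st t = [::].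
Proof.
move=> I; rewrite -(stack_last I).
have := @stack_layer s st t (last (center s t) (st t)) I.
case: (st t) => //= a q; rewrite mem_last => /(_ isT) h e.
by rewrite -e ltnn in h.
Qed.

Lemma stack_connect s st t x : tree_inv s st -> x \in center s t :: st t ->
  connect (@edge H) x (center s t).
Proof.
move=> I; have := stack_path I t; move: (st t) (center s t).
elim=> [|a q IH] c /=; first by rewrite inE => _ /eqP ->; apply: connect0.
case/andP=> [/eqP /(parent_edge I) ac /IH {}IH].
rewrite inE => /predU1P[->|/IH xa]; first exact: connect0.
exact: connect_trans xa (connect1 ac).
Qed.

Lemma owned_connect s st t x : tree_inv s st -> owned s t x ->
  connect (@edge H) (root t) x.
Proof.
move=> I; elim/layer_ind: x => x IH [->|[w xw cw]]; first exact: connect0.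
have wx := parent_edge I xw.
exact: connect_trans (IH _ (edge_layer wx) (colour_owned I cw)) (connect1 wx).
Qed.

Lemma visited_connect s st x : tree_inv s st -> colour s x <> None ->
  exists2 a, a \in [set r; g] & connect (@edge H) a x.
Proof.
move=> I; case E: (colour s x) => [t|] // _; exists (root t).
  by rewrite !inE; case: t {E}; rewrite eqxx ?orbT.
exact: owned_connect I (colour_owned I E).
Qed.

(** Serves both for visiting a new vertex and for stepping onto the other center; hence the new
    phase and colouring are left abstract. *)
Lemma descend_tree_inv s st t u ph col : tree_inv s st -> can_explore s t u ->
  colour s (center s t) = Some t -> u <> root t -> col u <> None ->
  (forall x, colour s x <> None -> col x = colour s x) ->
  (forall x t', col x = Some t' -> colour s x = Some t' \/ x = u /\ t' = t) ->
  tree_inv {| st_phase := ph; center := upd (center s) t u;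
              barrier := barrier s; colour := col;
              parent := upd (parent s) t (upd (parent s t) u (Some (center s t)));
              explored := (center s t, u) |: explored s |}
           (upd st t (center s t :: st t)).
Proof.
set s' := {| st_phase := _ |}.
move=> I /and4P[_ _ cu cue] ct ur uN old new.
have vis x : colour s x <> None -> col x <> None by move=> vx; rewrite old.
have par t' x : (t' != t) || (x != u) -> parent s' t' x = parent s t' x.
  by rewrite /= /upd; case: eqP => [->|//] /= /negbTE ->.
have paru : parent s' t u = Some (center s t) by rewrite /= !upd_same.
have ownu : owned s' t u by right; exists (center s t); rewrite //= old ct.
have own t' x : (t' != t) || (x != u) -> owned s t' x -> owned s' t' x.
  move=> h [->|[w xw cw]]; [by left|right]; exists w; first by rewrite par.
  by rewrite /= old ?cw.
split.
- move=> t' /=; rewrite /upd; case: eqP => // _.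
  exact: (vis _ (visited_center I t')).
- move=> t'; exact: (vis _ (visited_root I t')).
- move=> x y /=; rewrite !inE => /orP[/eqP[-> ->]|/(explored_edge I)[xy vx vy]].
    by split=> //; rewrite old ct.
  by split; auto.
- move=> t' x w; case: (boolP ((t' != t) || (x != u))) => [h|].
    by rewrite par // => /(parent_explored I) h'; rewrite inE h' orbT.
  rewrite negb_or !negbK => /andP[/eqP-> /eqP->]; rewrite paru => -[<-].
  by rewrite !inE eqxx.
- move=> t'; rewrite par; first exact: (parent_root I).
  by case: eqP => //= ->; apply/eqP => e; apply: ur.
- move=> t' x xt'; case: (boolP ((t' != t) || (x != u))) => [h|].
    apply: own => //; case: (new _ _ xt') => [/(colour_owned I)//|[xu tt]].
    by rewrite xu tt !eqxx in h.
  by rewrite negb_or !negbK => /andP[/eqP-> /eqP->].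
- move=> t' /=; rewrite /upd; case: eqP => [-> //|/eqP h].
  by apply: own (center_owned I t'); rewrite h.
- move=> t' /=; rewrite {1}/upd [upd st _ _ _]/upd; case: eqP => [->|/eqP h].
    rewrite /= !upd_same eqxx /=.
    (* All stack vertices are strictly higher than [u], so the parent pointer changed at [u] is not
       among those followed by the stack. *)
    apply: (@sub_in_path _ (fun y => layer u < layer y) _ _ _ _ _ _ (stack_path I t)).
      move=> x y ux _ /=; rewrite upd_other //; apply/eqP => xu.
      by rewrite -topredE /= xu ltnn in ux.
    rewrite /= edge_layer //=; apply/allP => x /(stack_layer I).
    by apply: ltn_trans; apply: edge_layer.
  by rewrite upd_other //; apply: stack_path.
- move=> t' /=; rewrite {1}/upd [upd st _ _ _]/upd; case: eqP => [->|/eqP h].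
    exact: (stack_last I t).
  exact: (stack_last I t').
- have fin x : finished s x -> finished s' x.
    move=> /forallP fx; apply/forallP => y; apply/implyP => xy.
    by rewrite inE (implyP (fx y) xy) orbT.
  move=> x /=; case E: (col x) => [t'|] // _.
  case: (new _ _ E) => [cx|[-> _]]; last first.
    by right; exists t; rewrite upd_same mem_head.
  have [|/fin ?|[t2 xt2]] := unfinished_stack I (x := x); first by rewrite cx.
    by left.
  right; exists t2; rewrite {1}/upd [upd st _ _ _]/upd.
  by case: eqP xt2 => [->|//] h; rewrite inE h orbT.
Qed.

Lemma skip_tree_inv s st t u : tree_inv s st -> can_explore s t u ->
  colour s u <> None ->
  tree_inv {| st_phase := st_phase s; center := center s;
              barrier := barrier s; colour := colour s;
              parent := parent s;
              explored := (center s t, u) |: explored s |} st.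
Proof.
move=> I /and4P[_ _ cu cue] uN; case: (I) => *; split=> //=.
- move=> x y /=; rewrite !inE => /orP[/eqP[-> ->]|/(explored_edge I)//].
  by split=> //; apply: visited_center.
- by move=> t' x w /(parent_explored I); rewrite inE orbC => ->.
- move=> x vx; case: (unfinished_stack I vx) => [/forallP fx|]; [left|by right].
  apply/forallP => y; apply/implyP => xy.
  by rewrite inE (implyP (fx y) xy) orbT.
Qed.

(** The popped vertex must not escape [unfinished_stack]: either it is finished, or the other tree
    still has its center there, as when a retreating tree leaves the meeting vertex. *)
Lemma backtrack_tree_inv s st t w a q : tree_inv s st ->
  st t = a :: q -> parent s t (center s t) = Some w ->
  (finished s (center s t) \/ center s t = center s (other t)) ->
  tree_inv {| st_phase := st_phase s; center := upd (center s) t w;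
              barrier := barrier s; colour := colour s;
              parent := parent s;
              explored := explored s |} (upd st t q).
Proof.
move=> I stE cw fin; have := stack_path I t; have := stack_last I t.
rewrite stE /= cw => la /andP[/eqP[wa] pq]; rewrite -{a}wa in la pq stE.
have [e vw vc] := explored_edge I (parent_explored I cw).
case: (I) => *; split=> //=.
- by move=> t'; rewrite /upd; case: eqP.
- move=> t'; rewrite /upd; case: eqP => [->|_]; last exact: (center_owned I).
  case: (center_owned I t) => [cr|[w']]; first by rewrite cr (parent_root I) in cw.
  by rewrite cw => -[<-] /(colour_owned I).
- by move=> t'; rewrite /upd; case: eqP => [->|_] //; apply: (stack_path I).
- by move=> t'; rewrite /upd; case: eqP => [->|_] //; apply: (stack_last I).
- move=> x vx; case: (unfinished_stack I vx) => [?|[t' xt']]; first by left.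
  case: (sideP t t') => [tt|[tt nt]]; last first.
    by right; exists t'; rewrite !upd_other.
  rewrite tt stE inE in xt'; case/predU1P: xt' => [->|xt'].
    case: fin => [|cc]; [by left|right; exists (other t)].
    by rewrite !upd_other ?other_neq // cc mem_head.
  by right; exists t; rewrite !upd_same.
Qed.

Lemma owned_sub s s' t x : parent s' t x = parent s t x ->
  (forall w, parent s t x = Some w -> colour s w = Some t ->
     colour s' w = Some t) ->
  owned s t x -> owned s' t x.
Proof.
move=> pE cE [->|[w xw cw]]; [by left|right].
by exists w; [rewrite pE|apply: cE].
Qed.

Lemma size_upd st t q :
  size (upd st t q Red) + size (upd st t q Green) + size (st t) =
  size q + size (st Red) + size (st Green).
Proof. by case: t; rewrite /upd /=; lia. Qed.

Lemma advance_moves s t : st_phase s = Advance -> moves s t ->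
  [/\ center s Red <> center s Green, ~~ both_lowest s
    & layer (center s (other t)) <= layer (center s t)].
Proof.
move=> Ph; rewrite /moves Ph => /and3P[/eqP d b /eqP ->]; split=> //.
by case: (leqP (layer (center s Green)) (layer (center s Red))) => //= /ltnW.
Qed.

Lemma retreat_moves s t t' v : st_phase s = Retreat t' v -> moves s t -> t' = t.
Proof. by move=> Ph; rewrite /moves Ph => /eqP. Qed.

Lemma center_neq s t : center s Red <> center s Green ->
  center s (other t) <> center s t.
Proof. by case: t => //= ? /esym. Qed.

(** Visited vertices other than the centers are no lower than the moving center, while edges
    descend. This excludes skipped edges while both trees advance. *)
Lemma advance_head s t u : advance_inv s ->
  st_phase s = Advance -> moves s t -> edge (center s t) u ->
  colour s u <> None -> u = center s (other t).
Proof.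
move=> A Ph /(advance_moves Ph)[d _ l] /edge_layer e vu.
case: (u =P center s (other t)) => // no; exfalso.
have [|/(_ t)] := advance_layer A vu; last by rewrite leqNgt e.
move=> t'; case: (sideP t t') => [->|[-> _]] // uc.
by rewrite -uc ltnn in e.
Qed.

Lemma moving_colour s t : phase_inv s -> moves s t -> ~~ at_meeting s t ->
  colour s (center s t) = Some t.
Proof.
rewrite /phase_inv /at_meeting; case Ph: (st_phase s) => [|t' v|v|] P M A.
- by apply: (advance_colour P); case: (advance_moves Ph M).
- by have := retreat_moves Ph M => tt; subst t'; apply: (retreat_center P); apply/eqP.
- by rewrite /moves Ph in M.
- by rewrite /moves Ph in M.
Qed.

(** A root different from [v] has kept its colour; the root of [t] is not [v], since that tree has
    left [v]; and [v] has the colour of the waiting tree. *)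
Lemma retreat_roots s t v : retreat_inv s t v -> center s t <> v ->
  forall t', colour s (root t') = Some t'.
Proof.
move=> P cv t'; case: (root t' =P v) => [rv|]; last exact: (meeting_root (retreat_meeting P)).
case: (sideP t t') => [tt|[-> _]] in rv *; last first.
  by rewrite rv; apply: (retreat_colour P).
by case: cv; apply: (retreat_root P); rewrite -rv tt.
Qed.

(** * Preservation of the invariant by each kind of step *)

Lemma visit_inv n s t u : ddfs_inv n s -> can_explore s t u ->
  colour s u = None ->
  ddfs_inv n.+1
    {| st_phase := phase_after_visit s u; center := upd (center s) t u;
       barrier := barrier s; colour := upd (colour s) u (Some t);
       parent := upd (parent s) t (upd (parent s t) u (Some (center s t)));
       explored := (center s t, u) |: explored s |}.
Proof.
case=> st [I P N] E uN; have /and4P[M A e ne] := E.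
have ct := moving_colour P M A.
have nu x : colour s x <> None -> x != u.
  by move=> vx; apply/eqP => xu; rewrite xu in vx.
have ur : u <> root t by move=> ur; case: (visited_root I t); rewrite -ur.
have cE x : colour s x <> None -> upd (colour s) u (Some t) x = colour s x.
  by move=> vx; rewrite upd_other ?nu.
have vis x : upd (colour s) u (Some t) x <> None -> x <> u -> colour s x <> None.
  by move=> vx /eqP xu; rewrite upd_other in vx.
(* Explored edges have visited tails, and the edge just taken does not start at [u]. *)
have unew u' : (u, u') \notin (center s t, u) |: explored s.
  rewrite !inE negb_or; apply/andP; split.
    by apply/eqP => -[uc _]; move: (edge_layer e); rewrite -uc ltnn.
  by apply/negP => /(explored_edge I)[_]; rewrite uN.
exists (upd st t (center s t :: st t)); split.
- apply: descend_tree_inv => //; first by rewrite upd_same.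
  by move=> x t'; rewrite /upd; case: eqP => [-> [<-]|_]; [right|left].
- rewrite /phase_inv /= /phase_after_visit.
  move: P; rewrite /phase_inv; case Ph: (st_phase s) => [|t' v|v|] P;
    try by rewrite /moves Ph in M.
    have [d _ l] := advance_moves Ph M.
    split=> /=.
    + move=> t' u'; case: (sideP t t') => [->|[tt nt]]; first by rewrite upd_same.
      rewrite upd_other // !inE negb_or (advance_fresh P) andbT.
      by apply/eqP => -[h _]; apply: (center_neq (t := t) d); rewrite -tt.
    + move=> x vx xc.
      have xu : x <> u by have := xc t; rewrite upd_same.
      have xo : x <> center s (other t).
        by have := xc (other t); rewrite upd_other ?other_neq.
      have {}vx := vis _ vx xu.
      have lx : layer (center s t) <= layer x.
        case: (x =P center s t) => [->//|xt].
        have [|/(_ t)//] := advance_layer P vx.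
        by move=> t'; case: (sideP t t') => [->|[-> _]].
      have ux := leq_trans (edge_layer e) lx.
      split; last by exists t; rewrite upd_same.
      move=> t'; case: (sideP t t') => [->|[-> h]].
        by rewrite upd_same ltnW.
      by rewrite upd_other ?other_neq // (leq_trans l).
    + move=> _ t'; case: (sideP t t') => [->|[_ h]]; first by rewrite !upd_same.
      rewrite [X in upd _ _ _ X]upd_other // cE; last exact: (visited_center I).
      exact: (advance_colour P).
    + by rewrite cE (advance_green P).
    + case: (advance_red P) => [h|h]; first by left; rewrite cE h.
      by case: d; rewrite !h.
  have tt := retreat_moves Ph M; subst t'.
  have /eqP cv : center s t != v by move: A; rewrite /at_meeting Ph.
  have Pm := retreat_meeting P.
  have vv : colour s v <> None by rewrite (retreat_colour P).
  have vfresh u' : (v, u') \notin (center s t, u) |: explored s.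
    rewrite !inE negb_or (meeting_fresh Pm) andbT.
    by apply/eqP => -[h _]; apply: cv.
  (* If [u] is at least as deep as [v], the search resumes with centers [u] and [v]; every other
     visited vertex is strictly above [v], hence above both. *)
  case: leqP => luv.
    split=> /=.
    + move=> t' u'; case: (sideP t t') => [->|[tt nt]]; first by rewrite upd_same.
      by rewrite upd_other // tt (retreat_other P).
    + move=> x vx xc.
      have xu : x <> u by have := xc t; rewrite upd_same.
      have xo : x <> v.
        by have := xc (other t); rewrite upd_other ?other_neq // (retreat_other P).
      have {}vx := vis _ vx xu.
      have lx := meeting_layer Pm vx xo.
      split; last by exists t; rewrite upd_same (leq_ltn_trans luv).
      move=> t'; case: (sideP t t') => [->|[-> h]].
        by rewrite upd_same ltnW // (leq_ltn_trans luv).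
      by rewrite upd_other ?other_neq // (retreat_other P) ltnW.
    + move=> _ t'; case: (sideP t t') => [->|[h' h]]; first by rewrite !upd_same.
      by rewrite [X in upd _ _ _ X]upd_other // h' (retreat_other P) cE // (retreat_colour P).
    + by have h := retreat_roots P cv Green; rewrite cE /= h.
    + by left; have h := retreat_roots P cv Red; rewrite cE /= h.
  split=> //=.
  + split=> //=.
    * move=> x vx xv; case: (x =P u) => [->//|xu].
      by apply: (meeting_layer Pm) => //; apply: vis.
    * move=> t'; apply: (owned_sub _ _ (meeting_owned Pm t')) => /=.
        by rewrite /upd; case: (t' =P t) => [->|//]; rewrite (negbTE (nu _ vv)).
      by move=> w _ cw; rewrite cE cw.
    * by move=> t' /(meeting_root Pm) h; rewrite cE h.
  + by rewrite upd_other ?other_neq // (retreat_other P).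
  + by rewrite cE // (retreat_colour P).
  + by rewrite !upd_same.
  + by move/(retreat_root P)/cv.
  + exact: (retreat_barrier P).
- have := size_upd st t (center s t :: st t).
  rewrite (nb_explored_new _ ne) //=.
  suff : credit s <= 2 by lia.
  rewrite /credit; case Ph: (st_phase s) => [|[] v|v|] //;
    try by rewrite /moves Ph in M.
  by case: ifP.
Qed.

Lemma reach_inv n s t u : ddfs_inv n s -> can_explore s t u -> meets s t u ->
  ddfs_inv n.+1
    {| st_phase := st_phase s; center := upd (center s) t u;
       barrier := barrier s; colour := colour s;
       parent := upd (parent s) t (upd (parent s t) u (Some (center s t)));
       explored := (center s t, u) |: explored s |}.
Proof.
case=> st [I P N] E; have /and4P[M A e ne] := E.
have ct := moving_colour P M A.
rewrite /meets; case Ph: (st_phase s) => // /eqP uE.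
have [d _ l] := advance_moves Ph M.
rewrite /phase_inv Ph in P.
(* The other alternative of [advance_red] puts both centers at [r], but they are distinct. Both
   roots thus have their own colour, so [u], coloured by the other tree, is not the root of [t]. *)
have cR : colour s r = Some Red.
  by case: (advance_red P) => // h; case: d; rewrite !h.
have cu : colour s u = Some (other t) by rewrite uE; apply: (advance_colour P).
have cE t' : upd (center s) t u t' = u.
  case: (sideP t t') => [->|[h' h]]; first by rewrite upd_same.
  by rewrite upd_other // h' -uE.
exists (upd st t (center s t :: st t)); split.
- apply: descend_tree_inv => //.
  + by move=> ur; move: cu; rewrite ur; case: (t) => /=; rewrite ?cR ?(advance_green P).
  + by rewrite cu.
  + by move=> x t'; left.
- rewrite /phase_inv /=; split=> /=.
  + move=> t' u'; rewrite cE !inE negb_or [X in (X, u') \notin _]uE (advance_fresh P) andbT.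
    by apply/eqP => -[h _]; apply: (center_neq (t := t) d); rewrite -uE.
  + move=> x vx xc.
    have xu : x <> u by have := xc t; rewrite cE.
    have lx : layer (center s t) <= layer x.
      case: (x =P center s t) => [->//|xt].
      have [|/(_ t)//] := advance_layer P vx.
      by move=> t'; case: (sideP t t') => [->|[-> _]] //; rewrite -uE.
    have ux := leq_trans (edge_layer e) lx.
    split; last by exists t; rewrite cE.
    by move=> t'; rewrite cE ltnW.
  + by rewrite !cE.
  + exact: (advance_green P).
  + by left.
- have := size_upd st t (center s t :: st t).
  rewrite (nb_explored_new _ ne) //= /credit /= !cE eqxx.
  suff : credit s <= 2 by lia.
  by rewrite /credit Ph; case: ifP.
Qed.

Lemma skip_inv n s t u : ddfs_inv n s -> can_explore s t u ->
  colour s u <> None -> ~~ meets s t u ->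
  ddfs_inv n.+1
    {| st_phase := st_phase s; center := center s;
       barrier := barrier s; colour := colour s;
       parent := parent s;
       explored := (center s t, u) |: explored s |}.
Proof.
case=> st [I P N] E vu; have /and4P[M A e ne] := E.
rewrite /meets; case Ph: (st_phase s) => [|t' v|v|];
  try by rewrite /moves Ph in M.
  rewrite /phase_inv Ph in P.
  by rewrite (advance_head P Ph M e vu) eqxx.
move=> _; have tt := retreat_moves Ph M; subst t'.
have /eqP cv : center s t != v by move: A; rewrite /at_meeting Ph.
exists st; split; first by rewrite -Ph; apply: skip_tree_inv.
  move: P; rewrite /phase_inv Ph /= => -[[]] *; split=> //; split=> //=.
  move=> u'; rewrite !inE negb_or; apply/andP; split=> //.
  by apply/eqP => -[h _]; apply: cv.
rewrite (nb_explored_new _ ne) //=.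
by move: N; rewrite /credit Ph /=; lia.
Qed.

Lemma backtrack_inv n s t w : ddfs_inv n s -> must_backtrack s t ->
  center s t != backtrack_limit g s t -> parent s t (center s t) = Some w ->
  ddfs_inv n.+1
    {| st_phase := st_phase s; center := upd (center s) t w;
       barrier := barrier s; colour := colour s;
       parent := parent s; explored := explored s |}.
Proof.
case=> st [I P N] /andP[M B] cl cw.
have cow : colour s w = Some t.
  case: (center_owned I t) => [cr|[w']]; first by rewrite cr (parent_root I) in cw.
  by rewrite cw => -[<-].
case Ph: (st_phase s) => [|t' v|v|]; try by rewrite /moves Ph in M.
  (* No backtracking while advancing: all out-edges of the center are unexplored, so it would have
     none and lie in layer 0 by the requirement, and so would the other center, which is not
     higher. *)
  rewrite /phase_inv Ph in P; exfalso.
  have [d /negP b l] := advance_moves Ph M.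
  rewrite /at_meeting Ph /= in B.
  have l0 : layer (center s t) = 0.
    apply/eqP; rewrite -leqn0 leqNgt; apply/negP => /(edge_requirement req)[u cu].
    have := implyP (forallP B u) cu.
    by apply/negP; apply: (advance_fresh P).
  apply: b; rewrite l0 leqn0 in l; rewrite /both_lowest.
  by case: t l0 l {M B cl cw cow} => /= -> ->.
have tt := retreat_moves Ph M; subst t'.
rewrite /phase_inv Ph in P.
case stE: (st t) => [|a q].
  by have := stack_last I t; rewrite stE /= => /eqP; rewrite (negbTE cl).
have I' := backtrack_tree_inv I stE cw.
rewrite -Ph; exists (upd st t q); split.
- apply: I'; move: B; rewrite /at_meeting Ph => /orP[/eqP ->|]; last by left.
  by right; rewrite (retreat_other P).
- rewrite /phase_inv /= Ph; case: P => Pm Po Pcol Pc Pr Pb; split=> //=.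
  + by case: Pm => *; split.
  + by rewrite upd_other ?other_neq.
  + by rewrite upd_same.
  + by move=> vr; move: (Pr vr) cw => ->; rewrite vr (parent_root I).
- have := size_upd st t q; rewrite stE /=.
  by move: N; rewrite /credit /nb_explored /= Ph; lia.
Qed.

Lemma meet_inv n s v : ddfs_inv n s -> st_phase s = Advance ->
  center s Red = v -> center s Green = v ->
  ddfs_inv n.+1
    {| st_phase := Retreat Red v; center := center s;
       barrier := barrier s; colour := upd (colour s) v (Some Green);
       parent := parent s; explored := explored s |}.
Proof.
case=> st [I P N] Ph cR cG; rewrite /phase_inv Ph in P.
have cv t : center s t = v by case: t.
have fresh u : (v, u) \notin explored s by rewrite -cR; apply: (advance_fresh P).
(* Recolouring [v] disturbs neither tree: its out-edges are unexplored, so it is nobody's parent. *)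
have own t x : owned s t x ->
    owned {| st_phase := Retreat Red v; center := center s;
       barrier := barrier s; colour := upd (colour s) v (Some Green);
       parent := parent s; explored := explored s |} t x.
  apply: owned_sub => // w /(parent_explored I) wx cw /=.
  rewrite upd_other //; apply/eqP => wv; move: wx; rewrite wv.
  by apply/negP.
have vis x : upd (colour s) v (Some Green) x <> None -> colour s x <> None.
  rewrite /upd; case: eqP => // -> _; rewrite -cR; exact: (visited_center I).
have vis' x : colour s x <> None -> upd (colour s) v (Some Green) x <> None.
  by rewrite /upd; case: eqP.
exists st; split.
- case: (I) => h1 h2 h3 h4 h5 h6 h7 h8 h9 h10; split=> //=.
  + by move=> t; apply: vis'.
  + by move=> t; apply: vis'.
  + by move=> x y /h3[? ? ?]; split=> //; apply: vis'.
  + move=> t x; rewrite /upd; case: eqP => [-> [<-]|_ /h6]; last exact: own.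
    by apply: own; have := h7 Green; rewrite cG.
  + by move=> t; apply: own.
  + by move=> x /vis /h10.
- split=> //=; last by rewrite upd_same.
  split=> //=.
  + move=> x /vis vx xv; have [|_ [t]] := advance_layer P vx; last by rewrite cv.
    by move=> t; rewrite cv.
  + by move=> t; apply: own; rewrite -(cv t); apply: (center_owned I).
  + case=> rv; rewrite upd_other; try by apply/eqP.
      by case: (advance_red P) => // h; case: rv; rewrite /= -(h Red).
    exact: (advance_green P).
- by move: N; rewrite /credit /nb_explored /= Ph cR cG eqxx; lia.
Qed.

Lemma red_fails_inv n s v : ddfs_inv n s -> st_phase s = Retreat Red v ->
  must_backtrack s Red -> center s Red = backtrack_limit g s Red ->
  ddfs_inv n.+1
    {| st_phase := Retreat Green v; center := upd (center s) Red v;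
       barrier := v; colour := upd (colour s) v (Some Red);
       parent := parent s; explored := explored s |}.
Proof.
case=> st [I P N] Ph /andP[_ B] cb; rewrite /phase_inv Ph in P.
have st0 := stack_nil I cb.
have Pm := retreat_meeting P.
have cG : center s Green = v := retreat_other P.
have cv t : upd (center s) Red v t = v by case: t; rewrite ?upd_same ?upd_other.
set s' := {| st_phase := _ |}.
have own t x : owned s t x -> owned s' t x.
  apply: owned_sub => // w /(parent_explored I) wx cw /=.
  rewrite upd_other //; apply/eqP => wv; move: wx; rewrite wv.
  by apply/negP; apply: (meeting_fresh Pm).
have vis x : upd (colour s) v (Some Red) x <> None -> colour s x <> None.
  by rewrite /upd; case: eqP => // -> _; rewrite -cG; exact: (visited_center I).
have vis' x : colour s x <> None -> upd (colour s) v (Some Red) x <> None.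
  by rewrite /upd; case: eqP.
exists (upd st Red [::]); split.
- case: (I) => h1 h2 h3 h4 h5 h6 h7 h8 h9 h10; split=> //=.
  + by move=> t; rewrite cv upd_same.
  + by move=> t; apply: vis'.
  + by move=> x y /h3[? ? ?]; split=> //; apply: vis'.
  + move=> t x; rewrite /upd; case: eqP => [-> [<-]|_ /h6]; last exact: own.
    by apply: own; apply: (meeting_owned Pm).
  + by move=> t; rewrite cv; apply: own; apply: (meeting_owned Pm).
  + by case; rewrite ?upd_same ?upd_other.
  + by case; rewrite ?upd_same ?upd_other //=; apply: (h9 Green).
  (* The red stack was empty, so only the old red center leaves the stacks; it is finished unless it
     is [v], which is the new red center. *)
  + move=> x /vis vx; have [xv|xv] := boolP (x == v).
      by right; exists Red; rewrite !upd_same inE.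
    case: (h10 x vx) => [?|[[]]]; first by left.
      rewrite st0 inE => /eqP xc; left; rewrite xc.
      by move: B; rewrite /at_meeting Ph -xc (negbTE xv).
    by move=> h; right; exists Green; rewrite !upd_other.
- split=> //=.
  + split=> //=; first exact: (meeting_fresh Pm).
    * by move=> x /vis; apply: (meeting_layer Pm).
    * by move=> t; apply: own; apply: (meeting_owned Pm).
    * by move=> t rv; rewrite upd_other; [apply: (meeting_root Pm)|apply/eqP].
  + by rewrite upd_same.
- by move: N; rewrite /s' /credit /nb_explored /= Ph st0 [upd _ _ _ Green]upd_other //=; lia.
Qed.

(** The red center waits at its barrier [v] and the green one is back at [g], so both stacks are
    empty. An unfinished visited vertex would be a center, and the green center is finished unless
    it is [v]. *)
Lemma green_fails_inv n s v : ddfs_inv n s -> st_phase s = Retreat Green v ->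
  must_backtrack s Green -> center s Green = backtrack_limit g s Green ->
  ddfs_inv n.+1
    {| st_phase := HaltBottleneck v; center := center s;
       barrier := barrier s; colour := colour s;
       parent := parent s; explored := explored s |}.
Proof.
case=> st [I P N] Ph /andP[_ B] cb; rewrite /phase_inv Ph in P.
have stG := stack_nil I cb.
have cR : center s Red = v := retreat_other P.
have stR : st Red = [::].
  by apply: (stack_nil I); rewrite cR /= (retreat_barrier P).
exists st; split; first by case: I => *; split.
- split=> /=; first by case: P => -[] *; split.
  move=> x vx xv; case: (unfinished_stack I vx) => // -[[]].
    by rewrite stR inE cR => /eqP.
  rewrite stG inE => /eqP xc; move: B; rewrite /at_meeting Ph -xc.
  by move/eqP/negbTE: xv => ->.
- by move: N; rewrite /credit /nb_explored /= Ph; lia.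
Qed.

Lemma halt_inv n s : ddfs_inv n s -> st_phase s = Advance ->
  center s Red <> center s Green -> both_lowest s ->
  ddfs_inv n.+1
    {| st_phase := HaltDisjoint; center := center s;
       barrier := barrier s; colour := colour s;
       parent := parent s; explored := explored s |}.
Proof.
case=> st [I P N] Ph d b; rewrite /phase_inv Ph in P.
exists st; split; first by case: I => *; split.
- by split=> //; case: P => *; split.
- by move: N; rewrite /credit /nb_explored /= Ph; case: eqP d => // _ _; lia.
Qed.

Lemma step_inv n s s' : ddfs_inv n s -> ddfs_step g s s' -> ddfs_inv n.+1 s'.
Proof.
move=> I; case.
- by move=> *; apply: visit_inv.
- by move=> *; apply: reach_inv.
- by move=> *; apply: skip_inv.
- by move=> *; apply: backtrack_inv.
- by move=> *; apply: meet_inv.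
- by move=> *; apply: red_fails_inv.
- by move=> *; apply: green_fails_inv.
- by move=> *; apply: halt_inv.
Qed.

(** * Runs: progress, step count, and the tree paths read off at the end *)

Lemma run_inv n s : ddfs_run g n (ddfs_init r g) s -> ddfs_inv n s.
Proof.
suff gen m n' s1 s2 : ddfs_inv m s1 -> ddfs_run g n' s1 s2 -> ddfs_inv (m + n') s2.
  by move=> /(gen 0 _ _ _ init_inv).
move=> I run; elim: run m I => {n' s1 s2} [s1|n' s1 s2 s3 st _ IH] m I.
  by rewrite addn0.
by rewrite addnS -addSn; apply: IH; apply: step_inv I st.
Qed.

(** While advancing, the requirement gives the mover an out-edge, which is unexplored. In a retreat,
    a tree with nothing to explore either pops its stack or stands at its limit and fails. *)
Lemma progress n s : ddfs_inv n s ->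
  (exists s', ddfs_step g s s') \/ (exists out, ddfs_result s = Some out).
Proof.
case=> st [I P N].
have explore t u : can_explore s t u -> exists s', ddfs_step g s s'.
  move=> E; case C: (colour s u) => [t'|]; last by eexists; apply: (StepVisit g E C).
  case: (boolP (meets s t u)) => m; first by eexists; apply: (StepReachCenter g E m).
  by eexists; apply: (StepSkip g E _ m); rewrite C.
case Ph: (st_phase s) => [|t v|v|]; last 2 first.
- by right; rewrite /ddfs_result Ph; eexists.
- by right; rewrite /ddfs_result Ph; eexists.
- left; rewrite /phase_inv Ph in P.
  case: (center s Red =P center s Green) => [c|d].
    by eexists; apply: (StepMeet g Ph c).
  case: (boolP (both_lowest s)) => b; first by eexists; apply: StepHalt.
  pose t := if layer (center s Green) <= layer (center s Red) then Red else Green.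
  have M : moves s t by rewrite /moves Ph b eqxx !andbT; apply/eqP.
  have [_ _ l] := advance_moves Ph M.
  have : 0 < layer (center s t).
    rewrite lt0n; apply/eqP => l0; move: b; rewrite l0 leqn0 in l.
    by rewrite /both_lowest; case: (t) l0 l => /= -> ->.
  case/(edge_requirement req) => u cu; apply: (explore t u).
  by rewrite /can_explore M cu (advance_fresh P) /at_meeting Ph.
left; have M : moves s t by rewrite /moves Ph.
case: (boolP (must_backtrack s t)) => [B|]; last first.
  rewrite /must_backtrack M /= negb_or => /andP[A /forallPn[u]].
  rewrite negb_imply => /andP[cu ne]; apply: (explore t u).
  by rewrite /can_explore M A cu ne.
case: (center s t =P backtrack_limit g s t) => cl.
  by case: t {M} Ph P B cl => Ph P B cl; eexists;
    [apply: (StepRedFails Ph B cl)|apply: (StepGreenFails Ph B cl)].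
have := stack_path I t; have := stack_last I t.
case: (st t) => [//|w q] /= _ /andP[/eqP cw _].
by eexists; apply: (StepBacktrack B _ cw); apply/eqP.
Qed.

Lemma nb_explored_bound n s : ddfs_inv n s -> n <= 4 * nb_explored s + 3.
Proof.
case=> st [_ _ N]; suff : credit s <= 3 by lia.
by rewrite /credit; case: (st_phase s) => [|[]|?|] //; case: ifP.
Qed.

(** Parents lie strictly higher, so the number of vertices above [x] is enough fuel and the path is
    never truncated. *)
Lemma tree_path_dipath s st t n x : tree_inv s st -> owned s t x ->
  #|[set y : H | layer x < layer y]| <= n ->
  dipath (root t) x (tree_path (parent s t) n x) /\
  (forall y, y \in tree_path (parent s t) n x -> y <> x ->
     colour s y = Some t).
Proof.
move=> I; elim: n x => [|n IH] x [xr|[w xw cw]] /=.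
- by rewrite xr eqxx => _; split=> // y; rewrite inE => /eqP.
- rewrite leqn0 cards_eq0 => /eqP/setP/(_ w); rewrite !inE.
  by rewrite edge_layer // (parent_edge I xw).
- rewrite xr (parent_root I) /= eqxx => _; split=> // y.
  by rewrite inE => /eqP.
- have wx := parent_edge I xw; have lwx := edge_layer wx.
  rewrite xw => lt_n; have [|pw cp] := IH _ (colour_owned I cw).
    rewrite -ltnS; apply: leq_trans lt_n; apply: proper_card.
    apply/properP; split; last by exists w; rewrite !inE ?ltnn.
    by apply/subsetP => y; rewrite !inE; apply: ltn_trans.
  split.
    have [q [-> rq qw]] := dipathP _ _ _ pw.
    by apply/dipathP; exists (rcons q x); rewrite rcons_path rq qw wx last_rcons.
  move=> y; rewrite mem_rcons inE => /predU1P[//|yp] _.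
  by case: (y =P w) => [->//|]; apply: cp.
Qed.

Lemma tree_path_card s st t x : tree_inv s st -> owned s t x ->
  dipath (root t) x (tree_path (parent s t) #|H| x) /\
  (forall y, y \in tree_path (parent s t) #|H| x -> y <> x ->
     colour s y = Some t).
Proof. by move=> I o; apply: tree_path_dipath I o (max_card _). Qed.

Lemma mem_roots t : root t \in [set r; g].
Proof. by case: t; rewrite !inE eqxx ?orbT. Qed.

(** * Correctness when a bottleneck is declared *)

Section Bottleneck.
Variables (s : state H) (st : side -> seq H) (b : H).
Hypotheses (I : tree_inv s st) (Pm : meeting_inv s b)
  (finish : forall x, colour s x <> None -> x <> b -> finished s x).

Lemma visited_succ x y : colour s x <> None -> x <> b -> edge x y ->
  colour s y <> None.
Proof.
move=> vx xb xy; have := implyP (forallP (finish vx xb) y) xy.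
by case/(explored_edge I).
Qed.

(** A visited vertex other than [b] is above [b], so it has an out-edge, whose head is visited
    because the vertex is finished. This descent can only stop at [b]. *)
Lemma visited_to_bottleneck x : colour s x <> None -> connect (@edge H) x b.
Proof.
elim/layer_ind_down: x => x IH vx; case: (x =P b) => [->|xb]; first exact: connect0.
have lx := meeting_layer Pm vx xb.
have [u xu] := edge_requirement req (leq_ltn_trans (leq0n _) lx).
apply: connect_trans (connect1 xu) (IH _ (edge_layer xu) _).
exact: visited_succ xu.
Qed.

Lemma path_visited x p : path (@edge H) x p -> colour s x <> None ->
  b \notin belast x p -> colour s (last x p) <> None.
Proof.
elim: p x => //= y p IH x /andP[xy yp] vx; rewrite inE negb_or => /andP[bx bp].
by apply: IH => //; apply: visited_succ xy => //; apply/eqP; rewrite eq_sym.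
Qed.

Lemma roots_visited x : x \in [set r; g] -> colour s x <> None.
Proof.
by rewrite !inE => /orP[]/eqP->;
  [apply: (visited_root I Red)|apply: (visited_root I Green)].
Qed.

(** A path from a root avoiding [b] stays among visited vertices, which are strictly above [b], so
    it cannot end in layer 0. *)
Lemma halt_bottleneck : bottleneck r g b.
Proof.
move=> x y p xrg ly /dipathP[q [-> xq qy]]; apply/negPn/negP => nb.
have bB : b \notin belast x q.
  by apply: contra nb => /mem_belast.
have := path_visited xq (roots_visited xrg) bB; rewrite qy => vy.
have : y <> b by move=> yb; rewrite -yb -qy mem_last in nb.
by move/(meeting_layer Pm vy); rewrite ly.
Qed.

(** Prolong both tree paths to [b] by one path from [b] to layer 0. Another bottleneck lies on both;
    if it were not on the common tail, it would have both colours. *)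
Lemma halt_highest : highest_bottleneck r g b.
Proof.
split=> [|v vB vb]; first exact: halt_bottleneck.
have [y [p [ly /dipathP[q [_ bq qy]]]]] := req b.
have side t : v \in q \/ colour s v = Some t.
  have [/dipathP[qt [E rq qb]] ct] := tree_path_card I (meeting_owned Pm t).
  have : v \in root t :: qt ++ q.
    apply: vB (mem_roots t) ly _; apply/dipathP; exists (qt ++ q).
    by rewrite cat_path rq last_cat qb.
  rewrite -cat_cons mem_cat => /orP[vq|]; [right|by left].
  by apply: ct; [rewrite E|apply/eqP].
case: (side Red) => [vq|cR]; first exact: path_layer bq vq.
by case: (side Green) => [vq|]; [apply: path_layer bq vq|rewrite cR].
Qed.

Lemma visited_vertices_on x :
  (x \in vertices_on [set r; g] [set b]) = (colour s x != None).
Proof.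
apply/idP/idP => [|/eqP vx]; last first.
  have [a aA ax] := visited_connect I vx.
  by apply: connect_vertices_on aA (set11 b) ax (visited_to_bottleneck vx).
rewrite inE => /asboolP[a [c [p [aA]]]]; rewrite inE => /eqP-> {c}.
case/dipathP=> q [-> aq qb] xq; apply/eqP.
case: (x =P b) => [->|xb].
  by case: (meeting_owned Pm Red) => [->|[w /(parent_explored I)/(explored_edge I)[]//]];
    apply: (visited_root I Red).
move: xq; rewrite inE => /predU1P[->|/splitPr xq]; first exact: roots_visited.
case: xq aq qb => q1 q2; rewrite -cat_rcons cat_path last_cat last_rcons => /andP[p1 p2] l2.
(* As [x] is above [b], the part of the path before [x] cannot contain [b], so being visited
   propagates along it up to [x]. *)
have lx : layer b < layer x.
  by case: (connect_layer (x := x) (y := b)) => //; apply/connectP; exists q2; rewrite ?l2 // -(last_rcons a q1).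
have := path_visited p1 (roots_visited aA); rewrite last_rcons; apply.
apply/negP => /(belast_layer p1); rewrite last_rcons ltnNge => /negP; apply.
exact: ltnW.
Qed.

Lemma explored_edges_on : nb_explored s <= #|edges_on [set r; g] [set b]|.
Proof.
apply: subset_leq_card; apply/subsetP => -[x u] /(explored_edge I)[xu vx vu].
have [a aA ax] := visited_connect I vx.
exact: connect_edges_on aA (set11 b) ax xu (visited_to_bottleneck vu).
Qed.

Lemma halt_tree t : spanning_tree (root t) (b |: coloured s t :\ b)
  (tree_edges s t (b |: coloured s t :\ b)).
Proof.
set S := b |: _.
have SE x : (x \in S) = (x == b) || (colour s x == Some t).
  by rewrite !inE; case: eqP.
(* Whatever its colour, [b] is attached to both trees by [meeting_owned]. *)
have SP x : x \in S -> owned s t x.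
  rewrite SE => /orP[/eqP->|/eqP]; first exact: (meeting_owned Pm).
  exact: (colour_owned I).
have cS x : colour s x = Some t -> x \in S by move=> cx; rewrite SE cx eqxx orbT.
clearbody S; split.
- rewrite SE; case: eqP => //= /(meeting_root Pm) ->; exact: eqxx.
- move=> [w x]; rewrite inE /= => /andP[xS /eqP xw]; split=> //.
    exact: parent_edge I xw.
  case: (SP _ xS) => [xr|[w']]; first by rewrite xr (parent_root I) in xw.
  by rewrite xw => -[->] /cS.
- move=> v vS; case: (v =P root t) => [->|vr] /=.
    apply/eqP; rewrite cards_eq0; apply/eqP/setP => -[w x]; rewrite !inE /=.
    by case: (x =P root t) => [->|]; rewrite ?andbF // (parent_root I) andbF.
  case: (SP _ vS) => // -[w vw _]; rewrite -(cards1 (w, v)); apply: eq_card => -[w' x].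
  rewrite !inE /= xpair_eqE.
  case: (x =P v) => [->|]; rewrite ?andbF // vS vw !andbT /=.
  by apply/eqP/eqP => [[->]|->].
- elim/layer_ind => x IH xS; case: (SP _ xS) => [->|[w xw cw]]; first exact: connect0.
  apply: connect_trans (IH w (edge_layer (parent_edge I xw)) (cS _ cw)) (connect1 _).
  by rewrite inE /= xS xw eqxx.
Qed.

Lemma halt_path t : exists p, dipath (root t) b p /\
  {subset p <= b |: coloured s t :\ b}.
Proof.
have [p c] := tree_path_card I (meeting_owned Pm t).
exists (tree_path (parent s t) #|H| b); split=> // y yp.
by rewrite !inE; case: eqP => //= yb; rewrite (c y) ?eqxx.
Qed.

End Bottleneck.

(** * Correctness when the centers end in layer 0 *)

Section Disjoint.
Variables (s : state H) (st : side -> seq H).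
Hypotheses (I : tree_inv s st) (P : advance_inv s)
  (d : center s Red <> center s Green) (low : both_lowest s).

Lemma center_lowest t : layer (center s t) = 0.
Proof. by case/andP: low => /eqP ? /eqP ?; case: t. Qed.

(** A vertex on a stack descends to the center of that stack. A finished vertex that is not a center
    is strictly above some center, so it has an out-edge, whose head is visited and lower. *)
Lemma visited_to_center x : colour s x <> None ->
  exists t, connect (@edge H) x (center s t).
Proof.
elim/layer_ind_down: x => x IH vx.
case: (x =P center s Red) => [->|xr]; first by exists Red; apply: connect0.
case: (x =P center s Green) => [->|xg]; first by exists Green; apply: connect0.
case: (unfinished_stack I vx) => [fx|[t /(stack_connect I)]]; last by exists t.
have [|_ [t]] := advance_layer P vx; first by case.
rewrite center_lowest => /(edge_requirement req)[u xu].
have [|t' ut'] := IH u (edge_layer xu).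
  by have := implyP (forallP fx u) xu; case/(explored_edge I).
by exists t'; apply: connect_trans (connect1 xu) ut'.
Qed.

Lemma explored_edges_on_centers :
  nb_explored s <= #|edges_on [set r; g] [set center s Red; center s Green]|.
Proof.
apply: subset_leq_card; apply/subsetP => -[x u] /(explored_edge I)[xu vx vu].
have [a aA ax] := visited_connect I vx.
have [t ut] := visited_to_center vu.
apply: connect_edges_on aA _ ax xu ut.
by case: (t); rewrite !inE eqxx ?orbT.
Qed.

Lemma center_path t :
  dipath (root t) (center s t) (tree_path (parent s t) #|H| (center s t)) /\
  forall y, y \in tree_path (parent s t) #|H| (center s t) ->
    colour s y = Some t.
Proof.
have [p c] := tree_path_card I (center_owned I t); split=> // y yp.
case: (y =P center s t) => [->|]; last exact: c.
exact: (advance_colour P).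
Qed.

End Disjoint.

End Invariant.

(** * Termination and the final statement *)

Lemma bounded_run_acc (H : layered_digraph) (g : H) N (s : state H) :
  (forall n s', ddfs_run g n s s' -> n <= N) ->
  Acc (fun s' s : state H => ddfs_step g s s') s.
Proof.
elim: N s => [|N IH] s bound; constructor=> s' ss'.
  by have := bound 1 s' (RunCons ss' (RunNil g s')).
(* The step to [s'] lengthens every run from [s'] by one, so the bound for [s'] is one less. *)
apply: IH => n s'' run; rewrite -ltnS.
exact: bound (RunCons ss' run).
Qed.

Theorem theorem2p1 :
  exists C : nat, forall (H : layered_digraph) (r g : H),
    ddfs_requirement H ->
    [/\ Acc (fun s' s : state H => ddfs_step g s s') (ddfs_init r g),
        (forall (n : nat) (s : state H), ddfs_run g n (ddfs_init r g) s ->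
           (exists s', ddfs_step g s s') \/
           (exists out, ddfs_result s = Some out)),
        (forall (n : nat) (s : state H) (b : H) (SR SG : {set H})
                (Tr Tg : {set H * H}),
           ddfs_run g n (ddfs_init r g) s ->
           ddfs_result s = Some (Case1 b SR SG Tr Tg) ->
           [/\ highest_bottleneck r g b,
               [/\ SR :|: SG = vertices_on [set r; g] [set b] :\ b,
                   [disjoint SR & SG],
                   (r != b -> r \in SR)
                 & (g != b -> g \in SG)],
               (exists p, dipath r b p /\ {subset p <= b |: SR}) /\
               (exists p, dipath g b p /\ {subset p <= b |: SG}),
               spanning_tree r (b |: SR) Tr /\ spanning_tree g (b |: SG) Tg
             & n <= C * maxn 1 #|edges_on [set r; g] [set b]|])
      & (forall (n : nat) (s : state H) (r0 g0 : H) (pr pg : seq H),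
           ddfs_run g n (ddfs_init r g) s ->
           ddfs_result s = Some (Case2 r0 g0 pr pg) ->
           [/\ ~ (exists v, bottleneck r g v),
               [/\ r0 <> g0, layer r0 = 0 & layer g0 = 0],
               [/\ dipath r r0 pr, dipath g g0 pg
                 & forall v, ~ (v \in pr /\ v \in pg)]
             & n <= C * maxn 1 #|edges_on [set r; g] [set r0; g0]|])].
Proof.
(* With [e] explored edges a run has at most [4 * e + 3] steps, and [4 * e + 3 <= 7 * maxn 1 e]. *)
exists 7 => H r g req; split.
(* There are finitely many pairs of vertices to explore, which bounds all runs uniformly. *)
- apply: (@bounded_run_acc _ _ (4 * #|{: H * H}| + 3)) => n s /(run_inv req) inv.
  have := nb_explored_bound inv.
  have : nb_explored s <= #|{: H * H}| by apply: max_card.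
  lia.
- by move=> n s /(run_inv req); apply: progress.
- move=> n s b SR SG Tr Tg /(run_inv req) inv.
  rewrite /ddfs_result; case Ph: (st_phase s) => [||v|] // [<- <- <- <- <-] {b SR SG Tr Tg}.
  have bound := nb_explored_bound inv.
  case: inv => st [I]; rewrite /phase_inv Ph => -[Pm fin] _.
  split.
  + exact: halt_highest I Pm fin.
  + split.
    * apply/setP => x; rewrite in_setU !in_setD1 (visited_vertices_on req I Pm fin) !inE.
      have [->|xv] /= := eqVneq x v; first by [].
      by case: (colour s x) => [[]|].
    * apply/pred0P => x; rewrite /= !inE.
      by case: (colour s x) => [[]|]; rewrite ?andbF.
    * move=> rv; rewrite !inE rv (meeting_root Pm (t := Red)) //; exact/eqP.
    * move=> gv; rewrite !inE gv (meeting_root Pm (t := Green)) //; exact/eqP.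
  + by split; [apply: (halt_path I Pm Red)|apply: (halt_path I Pm Green)].
  + by split; [apply: (halt_tree I Pm Red)|apply: (halt_tree I Pm Green)].
  + have := explored_edges_on req I Pm fin; lia.
- move=> n s r0 g0 pr pg /(run_inv req) inv.
  rewrite /ddfs_result; case Ph: (st_phase s) => [||v|] // [<- <- <- <-] {r0 g0 pr pg}.
  have bound := nb_explored_bound inv.
  case: inv => st [I]; rewrite /phase_inv Ph => -[P d low] _.
  have [pr cr] := center_path I P d Red.
  have [pg cg] := center_path I P d Green.
  have lc := center_lowest low.
  have disj v : ~ (v \in tree_path (parent s Red) #|H| (center s Red) /\
                   v \in tree_path (parent s Green) #|H| (center s Green)).
    by move=> [/cr h /cg]; rewrite h.
  split=> //.
  (* Both centers are in layer 0, so a bottleneck would lie on both tree paths. *)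
  + case=> v vB; apply: (disj v); split.
      exact: vB (mem_roots r g Red) (lc Red) pr.
    exact: vB (mem_roots r g Green) (lc Green) pg.
  + have := explored_edges_on_centers req I P low; lia.
Qed.
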